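(* Let $\alpha,\beta$ be real numbers with $0<\alpha<\beta$. Then the unicellular matrices $$A=\begin{bmatrix}0&\alpha&0\\0&0&\beta\\0&0&0\end{bmatrix}\quad\text{and}\quad A'=\begin{bmatrix}0&\beta&0\\0&0&\alpha\\0&0&0\end{bmatrix}$$ satisfy $\|f(A')\|=\|f(A)\|$ for all polynomials $f\in\mathbb{C}[t]$, but $A'$ is not unitarily similar to $A$ (that is, there is no $3\times 3$ unitary matrix $U$ with $A'=U^*AU$).
   Context: The norm of a complex $n\times n$ matrix is $\|X\|=\sqrt{\mathrm{spr}(X^*X)}$, where $\mathrm{spr}$ is the spectral radius; that is, the operator (spectral) norm, equivalently the largest singular value. A complex $n\times n$ matrix $A$ is called unicellular if $A$ is not similar to a matrix of the form $G\oplus H$ for some square matrices $G$ and $H$ of size strictly smaller than $n$. $\mathbb{C}[t]$ is the ring of polynomials in one variable with complex coefficients. *)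

(* Defs.v *)
From HB Require Import structures.
From mathcomp Require Import all_boot all_order all_algebra.
From mathcomp Require Import classical_sets reals.
From mathcomp Require Import complex.

Set Implicit Arguments.
Unset Strict Implicit.
Unset Printing Implicit Defensive.

Import Order.TTheory GRing.Theory Num.Theory.
Local Open Scope ring_scope.
Local Open Scope sesquilinear_scope.
Local Open Scope complex_scope.

(* The set of eigenvalues is finite, and nonempty when [0 < n], so this [sup]
   is a maximum; for [n = 0] it takes the conventional value [sup set0 = 0]. *)
Definition spr (R : realType) (n : nat) (X : 'M[R[i]]_n) : R :=
  sup [set r : R |
        exists2 l : R[i], eigenvalue X l & r = ComplexField.Normc.normc l]%classic.

Definition opnorm (R : realType) (n : nat) (X : 'M[R[i]]_n) : R :=
  Num.sqrt (spr (X ^t* *m X)).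

(* On [unitmx], [similar_in] is the usual similarity [P A P^-1 = B], since
   [pinvmx P = invmx P] there. *)
Definition unicellular (R : realType) (n : nat) (A : 'M[R[i]]_n) : Prop :=
  ~ exists (p q : nat) (epq : (p + q)%N = n) (G : 'M[R[i]]_p) (H : 'M[R[i]]_q),
      [/\ (p < n)%N, (q < n)%N &
          similar_in unitmx A (castmx (epq, epq) (block_mx G 0 0 H))].

Definition unitarily_similar (R : realType) (n : nat) (A B : 'M[R[i]]_n) : Prop :=
  exists U : 'M[R[i]]_n, U \is unitarymx /\ B = U ^t* *m A *m U.

Definition superdiag3 (R : realType) (a b : R) : 'M[R[i]]_3 :=
  \matrix_(i < 3, j < 3)
    (nth 0 (nth [::] [:: [:: 0; a; 0];
                         [:: 0; 0; b];
                         [:: 0; 0; 0]] i) j)%:C.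

(* Main.v *)
Require Import Defs.
From mathcomp Require Import all_boot all_order all_algebra.
From mathcomp Require Import classical_sets reals.
From mathcomp Require Import complex.
From mathcomp Require Import boolp perm.

(** Write [J] for the permutation matrix reversing the coordinates.  Reflecting
    a matrix in its antidiagonal is [X |-> J X^T J]; applied to [A] it swaps
    the two superdiagonal entries, so [A' = J A^T J] ([superdiag3_tr]), which
    says that [A'] is unitarily similar to the transpose of [A].  Polynomials
    commute with transposition and with conjugation by [J], so [f(A')] is
    unitarily similar to [f(A)^T].  The norm is invariant under unitary
    similarity and under transposition ([opnorm_unitary_conj], [opnorm_tr]);
    both invariances come from the fact that [X Y] and [Y X] have the same
    eigenvalues ([eigenvalue_mulmxC]).

    The matrices are unicellular because [0] is their only eigenvalue and they
    have rank 2: in a nontrivial decomposition [G (+) H] both blocks would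
    be singular and the rank would drop by at least two
    ([nilpotent_corank1_unicellular]).

    To see that [A] and [A'] are not unitarily similar, look at the line
    [im A^2], spanned by the first basis vector for both matrices.  There
    [A A^*] acts as the scalar [alpha^2], while [A' A'^*] acts as [beta^2].  In
    other words [X X^* X^2 = c X^2] holds for [A] with [c = alpha^2] and for
    [A'] with [c = beta^2] ([superdiag3_relation]); such a relation is
    transported by unitary similarity ([unitary_conj_relation]), and
    [A'^2 <> 0]. *)

Import Order.TTheory GRing.Theory Num.Theory.
Local Open Scope ring_scope.
Local Open Scope complex_scope.
Local Open Scope sesquilinear_scope.

(** * Eigenvalues of transposes and of products *)

Lemma eigenvalue_tr (F : fieldType) (n : nat) (A : 'M[F]_n) (a : F) :
  eigenvalue A^T a = eigenvalue A a.
Proof.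
rewrite !eigenvalue_root_char; congr (root _ a).
rewrite /char_poly -[RHS]det_tr; congr (\det _).
by rewrite /char_poly_mx linearB /= tr_scalar_mx map_trmx.
Qed.

Lemma eigenvalue0_det (F : fieldType) (n : nat) (A : 'M[F]_n) :
  eigenvalue A 0 = (\det A == 0).
Proof.
rewrite eigenvalue_root_char /root horner_coef0 char_poly_det.
by rewrite mulf_eq0 signr_eq0.
Qed.

(** For [a <> 0], the map [v |-> v X] sends eigenvectors of [X Y] to
    eigenvectors of [Y X], and it does not kill them since [v X Y = a v <> 0].
    The eigenvalue [0] is detected by the determinant, which is
    multiplicative. *)
Lemma eigenvalue_mulmxC (F : fieldType) (n : nat) (A B : 'M[F]_n) (a : F) :
  eigenvalue (A *m B) a = eigenvalue (B *m A) a.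
Proof.
have [->|a_neq0] := eqVneq a 0.
  by rewrite !eigenvalue0_det !det_mulmx mulrC.
suff sub (X Y : 'M[F]_n) : eigenvalue (X *m Y) a -> eigenvalue (Y *m X) a.
  by apply/idP/idP; apply: sub.
move=> /eigenvalueP[v vXY v_neq0]; apply/eigenvalueP; exists (v *m X).
  by rewrite mulmxA -(mulmxA v) vXY scalemxAl.
apply: contraNneq v_neq0 => vX0.
by move/eqP: vXY; rewrite mulmxA vX0 mul0mx eq_sym scaler_eq0 (negPf a_neq0).
Qed.

(** * Invariance of the operator norm *)

Lemma eq_spr (R : realType) (n : nat) (X Y : 'M[R[i]]_n) :
  (forall l, eigenvalue X l = eigenvalue Y l) -> spr X = spr Y.
Proof.
move=> eqXY; rewrite /spr.
have -> // : eigenvalue X = eigenvalue Y.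
by apply/funext => l; exact: eqXY.
Qed.

Lemma eq_opnorm (R : realType) (n : nat) (X Y : 'M[R[i]]_n) :
  (forall l, eigenvalue (X ^t* *m X) l = eigenvalue (Y ^t* *m Y) l) ->
  opnorm X = opnorm Y.
Proof. by move=> eqXY; rewrite /opnorm (eq_spr _ _ _ _ eqXY). Qed.

(** [(M^T)^* M^T] is the transpose of [M M^*], which has the eigenvalues of
    [M^* M]. *)
Lemma opnorm_tr (R : realType) (n : nat) (M : 'M[R[i]]_n) :
  opnorm M^T = opnorm M.
Proof.
apply: eq_opnorm => l.
have -> : M^T ^t* *m M^T = (M *m M ^t*)^T by rewrite trmx_mul -map_trmx.
by rewrite eigenvalue_tr eigenvalue_mulmxC.
Qed.

Lemma adjmxM (C : numClosedFieldType) (m n p : nat)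
    (X : 'M[C]_(m, n)) (Y : 'M[C]_(n, p)) :
  (X *m Y) ^t* = Y ^t* *m X ^t*.
Proof. by rewrite trmx_mul map_mxM. Qed.

Lemma adjmx_conj (C : numClosedFieldType) (n : nat) (U X : 'M[C]_n) :
  (U ^t* *m X *m U) ^t* = U ^t* *m X ^t* *m U.
Proof. by rewrite !adjmxM trmxCK mulmxA. Qed.

Lemma unitary_conjM (C : numClosedFieldType) (n : nat) (U X Y : 'M[C]_n) :
  U \is unitarymx ->
  (U ^t* *m X *m U) *m (U ^t* *m Y *m U) = U ^t* *m (X *m Y) *m U.
Proof. by move=> Uu; rewrite !mulmxA mulmxtVK. Qed.

Lemma eigenvalue_unitary_conj (C : numClosedFieldType) (n : nat)
    (U X : 'M[C]_n) (a : C) :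
  U \is unitarymx -> eigenvalue (U ^t* *m X *m U) a = eigenvalue X a.
Proof. by move=> Uu; rewrite -mulmxA eigenvalue_mulmxC mulmxtVK. Qed.

Lemma opnorm_unitary_conj (R : realType) (n : nat) (U M : 'M[R[i]]_n) :
  U \is unitarymx -> opnorm (U ^t* *m M *m U) = opnorm M.
Proof.
move=> Uu; apply: eq_opnorm => l.
rewrite adjmx_conj (unitary_conjM _ _ _ _ _ Uu).
exact: (eigenvalue_unitary_conj _ _ _ _ _ Uu).
Qed.

(** * Antidiagonal reflection *)

Lemma horner_mx_tr (K : comNzRingType) (n : nat) (A : 'M[K]_n.+1)
    (f : {poly K}) :
  horner_mx A^T f = (horner_mx A f)^T.
Proof.
elim/poly_ind: f => [|f c IHf]; first by rewrite !rmorph0 trmx0.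
rewrite !rmorphD !rmorphM /= !horner_mx_X !horner_mx_C linearD /= tr_scalar_mx.
have -> : horner_mx A f * A = A *m horner_mx A f.
  exact/esym/comm_mx_horner.
by rewrite IHf trmx_mul.
Qed.

Lemma perm_mx_unitary (C : numClosedFieldType) (n : nat) (s : 'S_n) :
  (perm_mx s : 'M[C]_n) \is unitarymx.
Proof.
by apply/unitarymxP; rewrite tr_perm_mx map_perm_mx -perm_mxM mulgV perm_mx1.
Qed.

(** Here [U^*] and [U] are both the coordinate reversal [J]; writing them this
    way displays the identity as a unitary similarity. *)
Lemma superdiag3_tr (R : realType) (a b : R) :
  let U : 'M[R[i]]_3 := perm_mx (perm (@rev_ord_inj 3))^-1 in
  superdiag3 b a = U ^t* *m (superdiag3 a b)^T *m U.
Proof.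
rewrite /= tr_perm_mx map_perm_mx invgK -row_permE -col_permE.
apply/matrixP => i j; rewrite !mxE !permE.
by case: i => [[|[|[|//]]] ?]; case: j => [[|[|[|//]]] ?].
Qed.

(** * Unicellularity *)

Lemma eigenvalue0_rank (F : fieldType) (n : nat) (A : 'M[F]_n) :
  eigenvalue A 0 = (\rank A < n)%N.
Proof.
rewrite eigenvalue0_det ltn_neqAle rank_leq_row andbT.
by rewrite -[_ == n]/(row_free A) row_free_unit unitmxE unitfE negbK.
Qed.

Lemma eigenvalue_block_diag (F : fieldType) (p q : nat)
    (G : 'M[F]_p) (H : 'M[F]_q) (l : F) :
  eigenvalue G l || eigenvalue H l -> eigenvalue (block_mx G 0 0 H) l.
Proof.
case/orP => /eigenvalueP[v vE v_neq0]; apply/eigenvalueP.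
  exists (row_mx v 0); last by rewrite row_mx_eq0 (negPf v_neq0).
  by rewrite mul_row_block !mul0mx !mulmx0 !addr0 vE scale_row_mx scaler0.
exists (row_mx 0 v); last by rewrite row_mx_eq0 (negPf v_neq0) andbF.
by rewrite mul_row_block !mul0mx !mulmx0 !add0r vE scale_row_mx scaler0.
Qed.

(** Over an algebraically closed field each block of positive size has an
    eigenvalue, which must be [0]; so each block is singular and
    contributes at least one to the corank. *)
Lemma rank_block_diag_nilpotent (C : numClosedFieldType) (p q : nat)
    (G : 'M[C]_p) (H : 'M[C]_q) :
  (0 < p)%N -> (0 < q)%N ->
  (forall l, eigenvalue (block_mx G 0 0 H) l -> l = 0) ->
  ((\rank (block_mx G 0 0 H)).+1 < p + q)%N.
Proof.
move=> p_gt0 q_gt0 spec0.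
have [l eigG] := eigenvalue_closed G p_gt0.
have [m eigH] := eigenvalue_closed H q_gt0.
have l0 : l = 0 by apply: spec0; apply: eigenvalue_block_diag; rewrite eigG.
have m0 : m = 0.
  by apply: spec0; apply: eigenvalue_block_diag; rewrite eigH orbT.
move: eigG eigH; rewrite {}l0 {}m0 !eigenvalue0_rank => ltG ltH.
by rewrite rank_diag_block_mx -addnS -addSn leq_add.
Qed.

(** For [0 < n] the hypotheses say that [A] is similar to a single nilpotent
    Jordan block; corank one leaves no room for two singular diagonal
    blocks. *)
Lemma nilpotent_corank1_unicellular (R : realType) (n : nat) (A : 'M[R[i]]_n) :
  (forall l, eigenvalue A l -> l = 0) -> (n <= (\rank A).+1)%N ->
  unicellular A.
Proof.
move=> spec0 rkA [p [q [epq [G [H [ltp ltq [P Pu simA]]]]]]].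
have p_gt0 : (0 < p)%N.
  by rewrite lt0n; apply: contraTneq ltq => p0; rewrite -epq p0 add0n ltnn.
have q_gt0 : (0 < q)%N.
  by rewrite lt0n; apply: contraTneq ltp => q0; rewrite -epq q0 addn0 ltnn.
case: _ / epq A P Pu simA spec0 rkA {ltp ltq} => A P Pu simA spec0 rkA.
have Bdef := similarRL Pu simA.
rewrite castmx_id in Bdef.
have: ((\rank (block_mx G 0 0 H)).+1 < p + q)%N.
  apply: (rank_block_diag_nilpotent _ _ _ _ _ p_gt0 q_gt0) => l.
  rewrite Bdef -mulmxA eigenvalue_mulmxC -mulmxA mulVmx // mulmx1.
  exact: spec0.
rewrite Bdef mxrankMfree ?row_free_unit ?unitmx_inv //.
rewrite (eqmxMfull _ _) ?row_full_unit //.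
by rewrite ltnNge rkA.
Qed.

Lemma superdiag3_unicellular (R : realType) (a b : R) :
  a != 0 -> b != 0 -> unicellular (superdiag3 a b).
Proof.
move=> a_neq0 b_neq0; apply: nilpotent_corank1_unicellular.
  move=> l; rewrite -eigenvalue_tr eigenvalue_root_char char_poly_trig.
    rewrite !big_ord_recl big_ord0 !mxE /= !subr0 mulr1 /root !hornerE.
    by rewrite !mulf_eq0 !orbb => /eqP.
  apply/is_trig_mxP => i j; rewrite !mxE.
  by case: i => [[|[|[|//]]] ?]; case: j => [[|[|[|//]]] ?].
(* The pseudo-inverse of the weighted shift exhibits its rank: the product is
   the projection on the first two coordinates. *)
have rk2 : \rank (superdiag3 a b *m (superdiag3 a^-1 b^-1)^T) = 2%N.
  rewrite -[RHS](@rank_pid_mx R[i] 3 3 2) //; congr (\rank _).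
  apply/matrixP => i j; rewrite !mxE !big_ord_recl big_ord0 !mxE.
  case: i => [[|[|[|//]]] ?]; case: j => [[|[|[|//]]] ?] /=;
  by rewrite ?mulr0 ?mul0r ?addr0 ?add0r -?rmorphM ?divff.
have := mxrankM_maxl (superdiag3 a b) (superdiag3 a^-1 b^-1)^T.
by rewrite rk2.
Qed.

(** * An obstruction to unitary similarity *)

Lemma mulmx_superdiag3 (R : realType) (a b : R) :
  superdiag3 a b *m superdiag3 a b = (a * b)%:C *: delta_mx 0 2.
Proof.
apply/matrixP => i j; rewrite !mxE !big_ord_recl big_ord0 !mxE.
case: i => [[|[|[|//]]] ?]; case: j => [[|[|[|//]]] ?] /=;
by rewrite ?mulr0 ?mul0r ?addr0 ?add0r ?mulr1 -?rmorphM.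
Qed.

(** [A A^*] is diagonal with first entry [a ^+ 2], and [A^2] has its image in
    the first coordinate axis. *)
Lemma superdiag3_relation (R : realType) (a b : R) :
  let A := superdiag3 a b in
  A *m A ^t* *m (A *m A) = (a ^+ 2)%:C *: (A *m A).
Proof.
have conjR (x : R) : Num.conj x%:C = x%:C by exact: conjc_real.
rewrite /= mulmx_superdiag3 -scalemxAr [RHS]scalerA.
rewrite [X in _ = X *: _]mulrC -scalerA; congr (_ *: _).
apply/matrixP => i j.
rewrite !mxE !big_ord_recl big_ord0 !mxE !big_ord_recl !big_ord0 !mxE.
case: i => [[|[|[|//]]] ?]; case: j => [[|[|[|//]]] ?] /=;
rewrite ?mulr0 ?mul0r ?addr0 ?add0r ?mulr1 -?rmorphM //.
  by rewrite conjR -rmorphM.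
by rewrite rmorph0 mulr0.
Qed.

Lemma unitary_conj_relation (C : numClosedFieldType) (n : nat)
    (U X : 'M[C]_n) (c : C) :
  U \is unitarymx -> X *m X ^t* *m (X *m X) = c *: (X *m X) ->
  let Y := U ^t* *m X *m U in Y *m Y ^t* *m (Y *m Y) = c *: (Y *m Y).
Proof.
move=> Uu relX Y; rewrite /Y adjmx_conj !unitary_conjM // relX.
by rewrite -scalemxAr -scalemxAl.
Qed.

Theorem proposition3p1 (R : realType) (alpha beta : R)
    (alpha_gt0 : 0 < alpha) (alpha_lt_beta : alpha < beta) :
  let A : 'M[R[i]]_3 := superdiag3 alpha beta in
  let A' : 'M[R[i]]_3 := superdiag3 beta alpha in
  [/\ unicellular A,
      unicellular A',
      forall f : {poly R[i]}, opnorm (horner_mx A' f) = opnorm (horner_mx A f)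
    & ~ unitarily_similar A A'].
Proof.
move=> A A'.
have beta_gt0 : 0 < beta := lt_trans alpha_gt0 alpha_lt_beta.
have a_neq0 : alpha != 0 by rewrite gt_eqF.
have b_neq0 : beta != 0 by rewrite gt_eqF.
split; try exact: superdiag3_unicellular.
  move=> f; rewrite /A' superdiag3_tr.
  set U := perm_mx _.
  have Uu : U \is unitarymx by exact: perm_mx_unitary.
  rewrite -(invmx_unitary Uu) horner_mx_uconjC; last exact: unitarymx_unit Uu.
  rewrite horner_mx_tr (invmx_unitary Uu).
  by rewrite (opnorm_unitary_conj _ _ _ _ Uu) opnorm_tr.
(* The relation for [A] with scalar [alpha ^+ 2], carried over to [A'], meets
   the one for [A'] with [beta ^+ 2]. *)
move=> [U [Uu A'E]].
have := unitary_conj_relation _ _ _ _ _ Uu (superdiag3_relation _ alpha beta).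
rewrite /= -A'E /A' superdiag3_relation mulmx_superdiag3.
move=> /matrixP/(_ 0 2); rewrite !mxE /= mulr1 -!rmorphM => /complexI.
have ba_neq0 : beta * alpha != 0 by rewrite mulf_neq0.
move=> /(mulIf ba_neq0)/eqP.
rewrite eqrXn2 ?ltW // => /eqP ab.
by move: alpha_lt_beta; rewrite ab ltxx.
Qed.
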